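(* Let $n\ge 1$ be an integer, let $\mu\in\mathbb{R}$ and let $F$ be a probability distribution on $\mathbb{R}$. Then $F$ is $n$-completely mixable with center $\mu$ if and only if there exist a probability measure $h$ on $\mathbb{R}^n$ and a family $(F_{\mathbf a})_{\mathbf a\in\mathbb{R}^n}$ of $n$-discrete uniform distributions with mean $\mu$ such that, for each fixed $x\in\mathbb{R}$, the map $\mathbf a\mapsto F_{\mathbf a}(x)$ is measurable on $\mathbb{R}^n$, and $$F=\int_{\mathbb{R}^n}F_{\mathbf a}\,\mathrm{d}h(\mathbf a),$$ i.e. $F(x)=\int_{\mathbb{R}^n}F_{\mathbf a}(x)\,\mathrm{d}h(\mathbf a)$ for all $x\in\mathbb{R}$.
   Context: ''Distribution'' means (Borel) probability measure; a distribution $F$ on $\mathbb{R}$ is identified with its distribution function $F(x)=F((-\infty,x])$. Measurability is with respect to Borel $\sigma$-algebras. All random variables live on an atomless probability space $(\Omega,\mathcal{A},\mathbb{P})$. A distribution $F$ on $\mathbb{R}$ is $n$-completely mixable with center $\mu$ if there exist random variables $X_1,\dots,X_n$, each with distribution $F$, such that $X_1+\dots+X_n=n\mu$ almost surely (equivalently, there is a probability measure on $\mathbb{R}^n$ with all one-dimensional margins equal to $F$ and supported in $\{(x_1,\dots,x_n): x_1+\dots+x_n=n\mu\}$). A distribution $G$ on $\mathbb{R}$ is an $n$-discrete uniform distribution on $(a_1,\dots,a_n)\in\mathbb{R}^n$ (entries not necessarily distinct) if $\mathbb{P}(X=x)=\#\{i\in\{1,\dots,n\}:a_i=x\}/n$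 for all $x\in\mathbb{R}$, where $X\sim G$. It is called an $n$-discrete uniform distribution if it is so on some vector in $\mathbb{R}^n$; its mean is $(a_1+\dots+a_n)/n$. *)

(* Defs.v *)
From HB Require Import structures.
From mathcomp Require Import all_boot all_order all_algebra.
From mathcomp Require Import all_classical all_reals all_analysis.
(* [all_analysis] does not export the sigma-algebra on [\bar R]. *)
From mathcomp Require Import measurable_realfun.

Set Implicit Arguments.
Unset Strict Implicit.
Unset Printing Implicit Defensive.

Import Order.TTheory GRing.Theory Num.Theory.
Local Open Scope classical_set_scope.
Local Open Scope ring_scope.

(* Distributions on the line are terms of [probability R R], [R] carrying its
   Borel sigma-algebra.  R^n is [n.-tuple R], whose sigma-algebra is generated
   by the coordinate maps, i.e., the Borel sigma-algebra of R^n. *)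

Definition atomless d (T : measurableType d) (R : realType)
    (P : probability T R) : Prop :=
  forall A : set T, measurable A -> (0 < P A)%E ->
  exists B : set T,
    [/\ measurable B, B `<=` A, (0 < P B)%E & (P B < P A)%E].

(* The equality is restricted to Borel sets because measures are functions on
   all sets, with irrelevant values outside the sigma-algebra. *)
Definition has_distribution d (T : measurableType d) (R : realType)
    (P : probability T R) (X : {RV P >-> R}) (F : probability R R) : Prop :=
  forall A : set R, measurable A -> distribution P X A = F A.

Definition completely_mixable d (Omega : measurableType d) (R : realType)
    (P : probability Omega R) (n : nat) (mu : R) (F : probability R R) : Prop :=
  exists X : 'I_n -> {RV P >-> R},
    (forall i, has_distribution (X i) F) /\
    {ae P, forall w, \sum_(i < n) X i w = n%:R * mu}.

Definition dfun (R : realType) (F : probability R R) (x : R) : \bar R :=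
  F `]-oo, x]%classic.

Definition discrete_uniform_on (R : realType) (n : nat) (a : n.-tuple R)
    (G : probability R R) : Prop :=
  forall x : R, G [set x] = (#|[pred i : 'I_n | tnth a i == x]|%:R / n%:R)%:E.

(* The mean does not depend on the choice of [a]: [G] determines the entries of
   [a] up to permutation. *)
Definition discrete_uniform_with_mean (R : realType) (n : nat) (mu : R)
    (G : probability R R) : Prop :=
  exists a : n.-tuple R,
    discrete_uniform_on a G /\ (\sum_(i < n) tnth a i) / n%:R = mu.

(* Main.v *)
Require Import Defs.
From HB Require Import structures.
From mathcomp Require Import all_boot all_order all_algebra.
From mathcomp Require Import all_classical all_reals all_analysis.
From mathcomp Require Import measurable_realfun lra.

Set Implicit Arguments.
Unset Strict Implicit.
Unset Printing Implicit Defensive.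

Import Order.TTheory GRing.Theory Num.Theory.
Local Open Scope classical_set_scope.
Local Open Scope ring_scope.

(** From a mixable law to a mixture, let [h] be the joint law of the vector
    [X] of random variables and let [F_a] be the uniform law on the entries of
    [a], with [a] replaced by a constant vector on the null set where its sum is
    not [n mu].  Averaging [P (X_i <= x) = F x] over [i] gives the mixture.

    Conversely, let [q a] be the vector of the atoms of [F_a] in increasing
    order.  It depends measurably on [a], since its [k]-th entry is at most [x]
    exactly when [F_a x] is at least [k / n] ([measurable_sorted_atoms]).  Draw
    [a] from [h] and then rotate [q a] by a uniformly chosen number of places.
    Rotations keep the sum [n mu], and every entry of the rotated vector has law
    [F], because a given entry is a uniformly chosen atom of [F_a].

    It remains to realise the law of this random vector on the given space,
    whose only known property is to be atomless ([atomless_tuple]).  By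
    Sierpinski's theorem a measure without atoms takes on subsets of [A] all
    values between 0 and the measure of [A] ([atomless_intermediate]).
    Splitting cells again and again in prescribed proportions then realises any law on
    infinite sequences of bits ([atomless_bitstream]), and a vector of reals is
    such a sequence once each entry is replaced by its rational cut
    ([rational_cutsK]). *)

(** * Sierpinski's theorem for atomless probabilities *)

(** A substitute for Zorn's lemma that asks only for countable unions: climb
    greedily, gaining at each step at least half of what can still be gained.  A
    larger [C] in [S] would bound every gain from below, and the measures of the
    sets built would be unbounded. *)
Lemma probability_exhaustion (R : realType) d (T : measurableType d)
    (P : probability T R) (S : set (set T)) (A0 : set T) :
  S A0 -> (forall A, S A -> measurable A) ->
  (forall B : (set T)^nat, (forall k, S (B k)) -> nondecreasing_seq B ->
    S (\bigcup_k B k)) ->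
  exists2 B, S B & forall C, S C -> B `<=` C -> (P C <= P B)%E.
Proof.
move=> SA0 Sm Sbigcup; pose p A := fine (P A).
have pE A : S A -> P A = (p A)%:E.
  by move=> /Sm mA; rewrite fineK// fin_num_measure.
have p_le A B : S A -> S B -> A `<=` B -> p A <= p B.
  move=> SA SB AB; rewrite -lee_fin -!pE//.
  by apply: le_measure => //; rewrite inE; exact: Sm.
have p_le1 A : S A -> p A <= 1.
  by move=> SA; rewrite -lee_fin -pE//; apply: probability_le1; exact: Sm.
have [next nextP] : exists next, forall B, S B ->
    [/\ S (next B), B `<=` next B &
     forall C, S C -> B `<=` C -> p C - p B <= 2 * (p (next B) - p B)].
  suff : forall B, exists B', S B -> [/\ S B', B `<=` B' &
     forall C, S C -> B `<=` C -> p C - p B <= 2 * (p B' - p B)].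
    by move=> /choice[f fP]; exists f.
  move=> B; have [SB|nSB] := pselect (S B); last by exists B.
  pose E := [set p C | C in [set C | S C /\ B `<=` C]].
  have supE : has_sup E.
    split; first by exists (p B), B => //; split.
    by exists 1 => _ [C [SC _] <-]; exact: p_le1.
  have E_le C : S C -> B `<=` C -> p C <= sup E.
    by move=> SC BC; apply: (sup_upper_bound supE); exists C.
  have := E_le _ SB (@subset_refl _ B).
  rewrite le_eqVlt => /predU1P[pB|pB].
    exists B => _; split=> // C SC BC; rewrite subrr mulr0 subr_le0 pB.
    exact: E_le.
  have e0 : 0 < (sup E - p B) / 2 by rewrite divr_gt0// subr_gt0.
  have [_ [B' [SB' BB'] <-] B'E] := sup_adherent e0 supE.
  exists B' => _; split=> // C SC BC; have := E_le _ SC BC.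
  by move: B'E => /=; lra.
pose B k := iter k next A0.
have SB k : S (B k) by elim: k => // k ih; case: (nextP _ ih).
have ndB : nondecreasing_seq B.
  apply/nondecreasing_seqP => k; apply/subsetPset.
  by case: (nextP _ (SB k)).
have SU := Sbigcup _ SB ndB.
exists (\bigcup_k B k) => // C SC BC.
rewrite pE// pE// lee_fin leNgt; apply/negP => ltBC.
pose del := p C - p (\bigcup_k B k).
have del0 : 0 < del by rewrite subr_gt0.
have pBk k : k%:R * (del / 2) <= p (B k).
  elim: k => [|k ih]; first by rewrite mul0r fine_ge0.
  have [_ _ /(_ C SC)] := nextP _ (SB k).
  have BkU : B k `<=` \bigcup_k B k by exact: bigcup_sup.
  move=> /(_ (subset_trans BkU BC)).
  have := p_le _ _ (SB k) SU BkU.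
  have -> : k.+1%:R * (del / 2) = k%:R * (del / 2) + del / 2.
    by rewrite -[k.+1%:R]natr1 mulrDl mul1r.
  move: ih; rewrite -[next (B k)]/(B k.+1) /del; move: (k%:R * _) => x.
  by lra.
have := pBk (Num.truncn (2 / del)).+1; rewrite leNgt => /negP; apply.
apply: (le_lt_trans (p_le1 _ (SB _))).
by rewrite -ltr_pdivrMr ?divr_gt0// mul1r invf_div truncnS_gt.
Qed.

(** One of the two parts of a proper splitting of [A] has at most half of its
    measure. *)
Lemma atomless_halving (R : realType) d (T : measurableType d)
    (P : probability T R) (A : set T) :
  atomless P -> measurable A -> (0 < P A)%E ->
  exists B, [/\ measurable B, B `<=` A, (0 < P B)%E & (2%:E * P B <= P A)%E].
Proof.
move=> aP mA A0; have [B [mB BA B0 BltA]] := aP A mA A0.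
have mAB := measurableD mA mB.
have fP C : measurable C -> P C = (fine (P C))%:E.
  by move=> mC; rewrite fineK// fin_num_measure.
have PAE : P A = (P B + P (A `\` B))%E.
  by rewrite -measureU ?setDIK// ?setDUK//.
move: PAE A0 B0 BltA; rewrite (fP A)// (fP B)// (fP (A `\` B))//.
rewrite -EFinD !lte_fin => -[AE] A0 B0 BltA.
have [le2|lt2] := leP (2 * fine (P B)) (fine (P A)).
  by exists B; rewrite (fP B)// (fP A)// lte_fin -EFinM lee_fin.
exists (A `\` B); rewrite (fP (A `\` B))// (fP A)// lte_fin -EFinM lee_fin.
by split=> //; lra.
Qed.

Lemma atomless_small (R : realType) d (T : measurableType d)
    (P : probability T R) (A : set T) (e : R) :
  atomless P -> measurable A -> (0 < P A)%E -> 0 < e ->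
  exists B, [/\ measurable B, B `<=` A, (0 < P B)%E & (P B <= e%:E)%E].
Proof.
move=> aP mA A0 e0.
have [k ke] : exists k, (2 ^+ k)^-1 <= e.
  exists (Num.truncn e^-1).+1; rewrite -[leRHS]invrK lef_pV2 ?posrE ?invr_gt0//.
    apply: ltW; apply: (lt_le_trans (truncnS_gt _)).
    by rewrite -natrX ler_nat ltnW// ltn_expl.
suff : exists B, [/\ measurable B, B `<=` A, (0 < P B)%E
    & ((2 ^+ k)%:E * P B <= 1)%E].
  move=> [B [mB BA B0 Bk]]; exists B; split=> //.
  apply: le_trans (_ : ((2 ^+ k)^-1)%:E <= _)%E; last by rewrite lee_fin.
  move: Bk; rewrite -[P B]fineK ?fin_num_measure// -EFinM !lee_fin => Bk.
  by rewrite -[leRHS]mul1r ler_pdivlMr ?exprn_gt0// mulrC.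
elim: k {ke} => [|k [B [mB BA B0 Bk]]].
  by exists A; rewrite expr0 mul1e; split=> //; exact: probability_le1.
have [C [mC CB C0 BC]] := atomless_halving aP mB B0.
exists C; split=> //; first exact: subset_trans BA.
apply: le_trans Bk; rewrite exprSr EFinM -muleA.
by rewrite lee_pmul2l ?lte_fin ?exprn_gt0.
Qed.

(** Take a maximal subset of measure at most [t]: were its measure smaller, a
    small piece of the rest of [A] would still fit. *)
Lemma atomless_intermediate (R : realType) d (T : measurableType d)
    (P : probability T R) (A : set T) (t : \bar R) :
  atomless P -> measurable A -> (0 <= t)%E -> (t <= P A)%E ->
  exists B, [/\ measurable B, B `<=` A & P B = t].
Proof.
move=> aP mA t0 tA.
pose S := [set C | [/\ measurable C, C `<=` A & (P C <= t)%E]].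
have [] := @probability_exhaustion _ _ _ P S set0.
- by split=> //; rewrite measure0.
- by move=> C [].
- move=> B SB ndB; have mB k : measurable (B k) by case: (SB k).
  have mU : measurable (\bigcup_k B k) by exact: bigcupT_measurable.
  split=> //; first by apply: bigcup_sub => k _; case: (SB k).
  have cvgB := nondecreasing_cvg_mu (mu := P) mB mU ndB.
  rewrite -(cvg_lim _ cvgB)//; apply: lime_le.
    by apply/cvg_ex; eexists; exact: cvgB.
  by apply: nearW => k /=; case: (SB k).
move=> B [mB BA Bt] Bmax; exists B; split=> //.
apply/eqP; rewrite eq_le Bt/= leNgt; apply/negP => ltBt.
have mAB := measurableD mA mB.
have fB : P B \is a fin_num by rewrite fin_num_measure.
have ft : t \is a fin_num.
  by rewrite ge0_fin_numE// (le_lt_trans tA)// -ge0_fin_numE// fin_num_measure.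
have AB0 : (0 < P (A `\` B))%E.
  rewrite measureD// ?setIidr//; last first.
    by rewrite -ge0_fin_numE// fin_num_measure.
  by rewrite sube_gt0// (lt_le_trans ltBt).
have e0 : 0 < fine t - fine (P B).
  by rewrite subr_gt0 fine_lt.
have [D [mD DAB D0 De]] := atomless_small aP mAB AB0 e0.
have PBD : P (B `|` D) = (P B + P D)%E.
  rewrite measureU//; apply/seteqP; split=> // x [Bx Dx].
  by case: (DAB _ Dx).
have /Bmax : S (B `|` D).
  split; first exact: measurableU.
    by rewrite subUset; split=> // x /DAB[].
  rewrite PBD; apply: (@le_trans _ _ (P B + (fine t - fine (P B))%:E)%E).
    by rewrite leeD2l.
  by rewrite EFinB !fineK// [leLHS]addeC subeK.
move=> /(_ (@subsetUl _ _ _)); rewrite leNgt => /negP; apply.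
by rewrite PBD lteDl.
Qed.

(** * Realising laws on bit sequences *)

(** The first [k] bits, latest first, so that refining a cylinder by one bit is
    a [cons]. *)
Fixpoint prefix_word (b : nat -> bool) (k : nat) : seq bool :=
  if k is j.+1 then b j :: prefix_word b j else [::].

Definition cylinder (w : seq bool) : set (nat -> bool) :=
  [set b | prefix_word b (size w) = w].

(** The empty set makes this generating family a pi-system. *)
Definition cylinders : set (set (nat -> bool)) := set0 |` range cylinder.

Definition bitstream : Type := g_sigma_algebraType cylinders.

HB.instance Definition _ := Measurable.on bitstream.

Lemma size_prefix_word b k : size (prefix_word b k) = k.
Proof. by elim: k => //= k ->. Qed.

Lemma cylinder_nil : cylinder [::] = setT.
Proof. exact/seteqP. Qed.

Lemma cylinder_cons x w :
  cylinder (x :: w) = cylinder w `&` [set b | b (size w) = x].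
Proof.
apply/seteqP; split=> b /=; first by move=> [-> ?].
by rewrite /cylinder/= => -[-> ->].
Qed.

Lemma measurable_cylinder w : measurable (cylinder w : set bitstream).
Proof. by apply: sub_sigma_algebra; right; exists w. Qed.

Lemma prefix_wordW b c k l : (k <= l)%N ->
  prefix_word c l = prefix_word b l -> prefix_word c k = prefix_word b k.
Proof.
elim: l => [|l ih]; first by rewrite leqn0 => /eqP ->.
by rewrite leq_eqVlt => /predU1P[->//|kl] /= [_]; exact: ih.
Qed.

Lemma setI_closed_cylinders : setI_closed cylinders.
Proof.
have cylI v w : (size v <= size w)%N -> cylinders (cylinder v `&` cylinder w).
  move=> vw.
  have [->|/set0P[b [bv bw]]] := eqVneq (cylinder v `&` cylinder w) set0.
    by left.
  right; exists w => //; apply/esym/setIidr => c cw.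
  have := prefix_wordW vw (etrans cw (esym bw)).
  by rewrite bv.
move=> A B [->|[v _ <-]] [->|[w _ <-]]; rewrite ?set0I ?setI0; try by left.
have [|/ltnW] := leqP (size v) (size w); first exact: cylI.
by rewrite setIC; exact: cylI.
Qed.

Lemma measurable_bit k : measurable_fun [set: bitstream] (fun b => b k).
Proof.
apply: (measurable_fun_bool true); rewrite setTI.
rewrite (_ : _ @^-1` _ =
    \bigcup_(w in [set w : seq bool | size w = k]) cylinder (true :: w)).
  rewrite bigcup_mkcond; apply: countable_bigcupT_measurable => // w.
  by case: ifP => _ //; exact: measurable_cylinder.
apply/seteqP; split=> [b /= bk|b [w /= wk]]; last by move=> [] <- _; rewrite wk.
exists (prefix_word b k); first exact: size_prefix_word.
by rewrite cylinder_cons; split; rewrite /cylinder/= size_prefix_word.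
Qed.

Lemma measurable_fun_bitstream d (T : measurableType d) (f : T -> bitstream) :
  (forall k, measurable_fun [set: T] (fun t => f t k)) ->
  measurable_fun [set: T] f.
Proof.
move=> mf; apply: (@measurability _ _ T bitstream setT f cylinders) => //.
move=> _ [_ [->|[w _ <-]] <-]; rewrite setTI ?preimage_set0//.
elim: w => [|x w ih]; first by rewrite cylinder_nil preimage_setT.
rewrite cylinder_cons preimage_setI; apply: measurableI => //.
rewrite [X in measurable X](_ : _ =
    setT `&` (fun t => f t (size w)) @^-1` [set x]).
  exact: mf.
by rewrite setTI.
Qed.

Lemma bitstream_probability_unique (R : realType)
    (P Q : {finite_measure set bitstream -> \bar R}) :
  (forall w, P (cylinder w) = Q (cylinder w)) ->
  forall A, measurable A -> P A = Q A.
Proof.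
move=> PQ A mA.
apply: (@measure_unique _ R bitstream cylinders (fun=> setT)) => //.
- exact: setI_closed_cylinders.
- by move=> _; right; exists [::] => //; exact: cylinder_nil.
- by rewrite bigcup_const//; exists 0%N.
- by move=> _ [->|[w _ <-]]; [rewrite !measure0|exact: PQ].
- by move=> _; rewrite -ge0_fin_numE// fin_num_measure.
Qed.

Section atomless_bitstream.
Variables (R : realType) (d : measure_display) (Omega : measurableType d).
Variables (P : probability Omega R) (P_atomless : atomless P).
Variable Q : probability bitstream R.

Let carve (A : set Omega) (t : \bar R) : set Omega :=
  xget set0 [set B | [/\ measurable B, B `<=` A & P B = t]].

Let carveP A t : measurable A -> (0 <= t)%E -> (t <= P A)%E ->
  [/\ measurable (carve A t), carve A t `<=` A & P (carve A t) = t].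
Proof.
move=> mA t0 tA; have [B BP] := atomless_intermediate P_atomless mA t0 tA.
by rewrite /carve; case: xgetP => [C _ //|/(_ B)]; case.
Qed.

Let cylinder_cons_le x w : (Q (cylinder (x :: w)) <= Q (cylinder w))%E.
Proof.
apply: le_measure; rewrite ?inE; try exact: measurable_cylinder.
by rewrite cylinder_cons; exact: subIsetl.
Qed.

(** A copy in [Omega] of the tree of cylinders, with the same measures. *)
Fixpoint cell (w : seq bool) : set Omega :=
  if w is x :: v then
    let C := carve (cell v) (Q (cylinder (true :: v))) in
    if x then C else cell v `\` C
  else setT.

Lemma cell_spec w : measurable (cell w) /\ P (cell w) = Q (cylinder w).
Proof.
elim: w => [|x w [mw Pw]].
  rewrite cylinder_nil; split; first exact: measurableT.
  exact: (etrans (probability_setT P) (esym (probability_setT Q))).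
have QP : (Q (cylinder (true :: w)) <= P (cell w))%E.
  rewrite Pw; apply: cylinder_cons_le.
have [mC Cw PC] := carveP mw (measure_ge0 Q _) QP.
case: x => //=; split; first exact: measurableD.
rewrite measureD//; last by rewrite -ge0_fin_numE// fin_num_measure.
rewrite setIidr//.
transitivity (Q (cylinder w) - Q (cylinder (true :: w)))%E.
  by congr (_ - _)%E.
rewrite [cylinder (false :: w)](_ : _ = cylinder w `\` cylinder (true :: w)).
  rewrite measureD ?setIidr//; try exact: measurable_cylinder.
  - by rewrite cylinder_cons; exact: subIsetl.
  - by rewrite -ge0_fin_numE// fin_num_measure//; exact: measurable_cylinder.
rewrite !cylinder_cons; apply/seteqP; split=> b /=.
  by move=> [? bw]; split=> // -[_]; rewrite bw.
by move=> [? nb]; split=> //; apply/negbTE/negP => bw; apply: nb.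
Qed.

(** The path of the cells that contain [o]. *)
Fixpoint address (o : Omega) (k : nat) : seq bool :=
  if k is j.+1 then `[< cell (true :: address o j) o >] :: address o j
  else [::].

Definition address_bits (o : Omega) : bitstream :=
  fun k => `[< cell (true :: address o k) o >].

Lemma prefix_word_address o k : prefix_word (address_bits o) k = address o k.
Proof. by elim: k => //= k ->. Qed.

Lemma address_cell w : address_bits @^-1` cylinder w = cell w.
Proof.
elim: w => [|x w ih]; first by rewrite cylinder_nil.
have [mw Pw] := cell_spec w.
have sub : cell (true :: w) `<=` cell w.
  have [] // := carveP mw (measure_ge0 Q (cylinder (true :: w))) _.
  by rewrite Pw cylinder_cons_le.
rewrite cylinder_cons preimage_setI ih; apply/seteqP; split=> o.
  move=> [ow]; rewrite /= /address_bits.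
  have : cylinder w (address_bits o).
    by rewrite -[cylinder w _]/((_ @^-1` _) _) ih.
  rewrite /cylinder/= prefix_word_address => ->.
  case: x; first by move=> /asboolP.
  by move=> /asboolPn no; split.
move=> ox; have ow : cell w o by case: x ox => [/sub//|[]].
split=> //=; rewrite /address_bits.
have : cylinder w (address_bits o).
  by rewrite -[cylinder w _]/((_ @^-1` _) _) ih.
rewrite /cylinder/= prefix_word_address => ->.
by case: x ox => [ox|[_ ox]]; [apply/asboolP|apply/asboolPn].
Qed.

Lemma measurable_address_bits : measurable_fun [set: Omega] address_bits.
Proof.
apply: (@measurability _ _ Omega bitstream setT _ cylinders) => //.
move=> _ [_ [->|[w _ <-]] <-]; rewrite setTI ?preimage_set0//.
by rewrite address_cell; case: (cell_spec w).
Qed.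

(** The map sending a point to its path pulls each cylinder back to the cell of
    the same measure, and cylinders form a pi-system. *)
Lemma atomless_bitstream : exists Z : Omega -> bitstream,
  measurable_fun [set: Omega] Z /\
  forall A, measurable A -> P (Z @^-1` A) = Q A.
Proof.
have mZ := measurable_address_bits.
exists address_bits; split=> // A mA.
pose Z : {mfun Omega >-> bitstream} := mfun_Sub (mem_set mZ).
apply: (bitstream_probability_unique (P := distribution P Z)) => // w.
exact: etrans (congr1 P (address_cell w)) (cell_spec w).2.
Qed.

End atomless_bitstream.

(** * Realising laws on tuples of reals *)

Section rational_cuts.
Variables (R : realType) (n : nat).

Definition rational_cuts (x : n.-tuple R) : bitstream := fun k =>
  if (unpickle k : option ('I_n * rat)) is Some (i, q)
  then tnth x i < ratr q else false.

(** The infimum over [k] of these bounds recovers the [i]-th entry; the indices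
    that carry no information about it contribute [+oo]. *)
Definition cut_bound (b : bitstream) (i : 'I_n) (k : nat) : \bar R :=
  if (unpickle k : option ('I_n * rat)) is Some (j, q)
  then if (j == i) && b k then (ratr q)%:E else +oo%E
  else +oo%E.

Definition tuple_of_cuts (b : bitstream) : n.-tuple R :=
  [tuple fine (einfs (cut_bound b i) 0) | i < n].

Lemma measurable_rational_cuts : measurable_fun [set: n.-tuple R] rational_cuts.
Proof.
apply: measurable_fun_bitstream => k; rewrite /rational_cuts.
case: unpickle => [[i q]|]; last exact: measurable_cst.
by apply: measurable_fun_ltr => //; exact: measurable_tnth.
Qed.

Lemma measurable_tuple_of_cuts : measurable_fun [set: bitstream] tuple_of_cuts.
Proof.
apply/measurable_fun_tnthP => i.
rewrite (_ : _ \o _ = fun b => fine (einfs (cut_bound b i) 0)); last first.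
  by apply/funext => b; rewrite /= tnth_mktuple.
apply: measurableT_comp; first exact: fine_measurable.
apply: measurable_fun_einfs => k; rewrite /cut_bound.
case: unpickle => [[j q]|]; last exact: measurable_cst.
apply: measurable_fun_ifT; last 2 first; [exact: measurable_cst..|].
case: (j == i) => /=; first exact: measurable_bit.
exact: measurable_cst.
Qed.

Lemma rational_cutsK : cancel rational_cuts tuple_of_cuts.
Proof.
move=> x; apply: eq_from_tnth => i; rewrite tnth_mktuple.
suff -> : einfs (cut_bound (rational_cuts x) i) 0 = (tnth x i)%:E by [].
apply/eqP; rewrite eq_le; apply/andP; split; last first.
  apply: le_ereal_inf_tmp => _ [k _ <-]; rewrite /cut_bound /rational_cuts.
  case: unpickle => [[j q]|]; last exact: leey.
  case: eqP => [->|_] /=; last exact: leey.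
  by case: ifP => [/ltW|_]; [rewrite lee_fin|exact: leey].
apply/lee_addgt0Pr => e e0.
have [q xq qe] : exists2 q : rat, tnth x i < ratr q & ratr q < tnth x i + e.
  have := @rat_in_itvoo R (tnth x i) (tnth x i + e).
  by rewrite ltrDl => /(_ e0)[q]; rewrite in_itv/= => /andP[]; exists q.
apply: (@le_trans _ _ (ratr q)%:E); last by rewrite -EFinD lee_fin ltW.
apply: ereal_inf_lbound; exists (pickle (i, q)) => //.
by rewrite /cut_bound /rational_cuts pickleK eqxx xq.
Qed.

End rational_cuts.

(** Realise the law of the cuts as a random bit sequence and decode it. *)
Lemma atomless_tuple (R : realType) d (Omega : measurableType d)
    (P : probability Omega R) (n : nat) (Q : probability (n.-tuple R) R) :
  atomless P -> exists X : Omega -> n.-tuple R,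
    measurable_fun [set: Omega] X /\
    forall A, measurable A -> P (X @^-1` A) = Q A.
Proof.
move=> aP; have mcut := @measurable_rational_cuts R n.
have muncut := @measurable_tuple_of_cuts R n.
pose f : {mfun n.-tuple R >-> bitstream} := mfun_Sub (mem_set mcut).
have [Z [mZ ZP]] := atomless_bitstream aP (distribution Q f).
exists (@tuple_of_cuts R n \o Z); split; first exact: measurableT_comp.
move=> A mA; rewrite comp_preimage ZP; last first.
  by rewrite -[_ @^-1` _]setTI; exact: muncut.
rewrite /distribution /pushforward/= -comp_preimage.
by congr (Q _); apply/seteqP; split=> x /=; rewrite rational_cutsK.
Qed.

(** * Averages and discrete uniform laws *)

Lemma dfun_unique (R : realType) (P Q : probability R R) :
  (forall x, dfun P x = dfun Q x) -> forall A, measurable A -> P A = Q A.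
Proof.
move=> PQ A mA.
have tailE (S : probability R R) x : S `]x, +oo[%classic = (1 - dfun S x)%E.
  by rewrite -setCitvl probability_setC.
apply: (@measure_unique _ R R (@RGenOInfty.G R)
  (fun k => `]- k%:R, +oo[%classic)) => //.
- exact: RGenOInfty.measurableE.
- move=> _ _ [x ->] [y ->]; exists (Num.max x y).
  by apply/seteqP; split=> z /=; rewrite !in_itv/= !andbT gt_max => /andP.
- by move=> k; exists (- k%:R).
- apply/seteqP; split=> // x _; exists (Num.truncn `|x|).+1 => //=.
  rewrite in_itv/= andbT ltrNl (le_lt_trans _ (truncnS_gt _))//.
  by rewrite -normrN ler_norm.
- by move=> _ [x ->]; apply: etrans (tailE P x) _; rewrite PQ -tailE.
- by move=> k; rewrite -ge0_fin_numE// fin_num_measure.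
Qed.

Section average.
Variables (R : realType) (d : measure_display) (T : measurableType d) (n : nat).
Variable m : 'I_n.+1 -> probability T R.

Definition average : set T -> \bar R :=
  mscale ((n.+1%:R : R)^-1)%:nng (msum (fun k => m (inord k)) n.+1).

HB.instance Definition _ := Measure.on average.

Lemma averageE A :
  average A = ((n.+1%:R : R)^-1%:E * \sum_(i < n.+1) m i A)%E.
Proof.
rewrite /average /mscale/= /msum; congr (_ * _)%E.
by apply: eq_bigr => i _; rewrite inord_val.
Qed.

Let average_setT : average setT = 1%E.
Proof.
rewrite averageE (eq_bigr (fun=> 1%E)) => [|i _]; last exact: probability_setT.
by rewrite sumEFin -EFinM sumr_const card_ord mulVf.
Qed.

HB.instance Definition _ :=
  Measure_isProbability.Build _ _ _ average average_setT.

End average.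

Section discrete_uniform.
Variables (R : realType) (n : nat).
Implicit Types (a : n.+1.-tuple R) (G : probability R R).

Definition uniform_on a : probability R R := average (fun i => \d_(tnth a i)).

Lemma uniform_onE a A :
  uniform_on a A = ((n.+1%:R)^-1%:E * \sum_(i < n.+1) (\1_A (tnth a i))%:E)%E.
Proof. exact: averageE. Qed.

Lemma uniform_on_count a (p : pred R) :
  uniform_on a [set` p] = ((count p a)%:R / n.+1%:R)%:E.
Proof.
rewrite uniform_onE sumEFin -EFinM mulrC; congr (_ * _)%:E.
rewrite -sum1_count big_tuple natr_sum [RHS]big_mkcond/=.
by apply: eq_bigr => i _; rewrite indicE mem_setE unfold_in; case: (p _).
Qed.

Lemma discrete_uniform_on_uniform a : discrete_uniform_on a (uniform_on a).
Proof.
move=> x; rewrite (_ : [set x] = [set` pred1 x]); last first.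
  by apply/seteqP; split=> y /=; [move=> ->; exact: eqxx|move=> /eqP].
rewrite uniform_on_count; congr (_%:R / _)%:E.
rewrite -sum1_count big_tuple -sum1_card; apply: eq_bigl => i.
by rewrite inE.
Qed.

(** The hypothesis gives the measure of points only, hence of finite sets.  As
    the atoms already carry all the mass of [uniform_on a], [G] is at least
    [uniform_on a] on every Borel set; applied to a set and to its complement,
    this forces equality. *)
Lemma discrete_uniform_onE a G : discrete_uniform_on a G ->
  forall A, measurable A -> G A = uniform_on a A.
Proof.
move=> aG; pose V := [set` a : seq R].
have finV : finite_set V by exact: finite_seq.
have onV A : G (A `&` V) = uniform_on a (A `&` V).
  have finA : finite_set (A `&` V) by exact: finite_setIr.
  rewrite -[A `&` V]image_id -bigcup_imset1 !measure_fin_bigcup//.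
  - apply: eq_fsbigr => x _.
    exact: etrans (aG x) (esym (discrete_uniform_on_uniform a x)).
  - by move=> i j _ _ [x [-> ->]].
  - by move=> i j _ _ [x [-> ->]].
have geG A : measurable A -> (uniform_on a A <= G A)%E.
  move=> mA; rewrite (_ : uniform_on a A = uniform_on a (A `&` V)).
    rewrite -onV le_measure ?inE//.
    apply: measurableI => //; apply: countable_measurable => //.
    exact: finite_set_countable.
  rewrite !uniform_onE; congr (_ * _)%E; apply: eq_bigr => i _.
  have Vi : tnth a i \in V by rewrite inE /V/= mem_tnth.
  by rewrite !indicE in_setI Vi andbT.
move=> A mA; apply/eqP; rewrite eq_le geG// andbT.
have := geG _ (measurableC mA); rewrite !probability_setC//.
rewrite -[G A]fineK ?fin_num_measure//.
rewrite -[uniform_on a A]fineK ?fin_num_measure//.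
by rewrite -!EFinB !lee_fin; lra.
Qed.

Lemma tnth_sort_tuple_le a (k : 'I_n.+1) x :
  (tnth (sort_tuple <=%R a) k <= x) = (k < count (<= x) a)%N.
Proof.
have ss : sorted <=%R (sort_tuple <=%R a) by exact: sort_le_sorted.
have -> : count (<= x) a = count (<= x) (sort_tuple <=%R a).
  by apply/permP; rewrite perm_sym; exact/permPl/perm_sort.
rewrite (tnth_nth 0); have [kx|kx] := ltnP.
  by rewrite nth_count_le.
by apply/negbTE; rewrite -ltNge nth_count_gt// kx size_tuple/=.
Qed.

Lemma uniform_on_sort a A : uniform_on (sort_tuple <=%R a) A = uniform_on a A.
Proof.
rewrite !uniform_onE; congr (_ * _)%E.
rewrite -!(big_tuple _ _ _ xpredT (fun x : R => (\1_A x)%:E)).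
by apply: perm_big; exact/permPl/perm_sort.
Qed.

Section integral_uniform_on.
Variables (d : measure_display) (T : measurableType d).
Variables (q : T -> n.+1.-tuple R) (A : set R).
Hypotheses (mq : measurable_fun [set: T] q) (mA : measurable A).

Let measurable_preimage_tnth i : measurable [set t | A (tnth (q t) i)].
Proof.
have /measurable_fun_tnthP/(_ i) mqi := mq.
by rewrite -[X in measurable X]setTI; exact: mqi.
Qed.

Let indic_tnth i : (fun t => \1_A (tnth (q t) i)) =
  \1_[set t | A (tnth (q t) i)] :> (T -> R).
Proof.
by apply/funext => t; rewrite !indicE.
Qed.

Let measurable_indic_tnth i :
  measurable_fun [set: T] (fun t => (\1_A (tnth (q t) i))%:E : \bar R).
Proof.
by apply/measurable_EFinP; rewrite indic_tnth; exact: measurable_indic.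
Qed.

Lemma measurable_uniform_on :
  measurable_fun [set: T] (fun t => uniform_on (q t) A).
Proof.
rewrite (_ : (fun t => _) = fun t =>
    ((n.+1%:R)^-1%:E * \sum_(i < n.+1) (\1_A (tnth (q t) i))%:E)%E); last first.
  by apply/funext => t; rewrite uniform_onE.
by apply: emeasurable_funM => //; exact: emeasurable_sum.
Qed.

(** The identity behind both directions: a mixture of the uniform laws on [q t]
    is the average of the laws of the entries of [q]. *)
Lemma integral_uniform_on (h : probability T R) :
  (\int[h]_t uniform_on (q t) A =
   (n.+1%:R)^-1%:E * \sum_(i < n.+1) h [set t | A (tnth (q t) i)])%E.
Proof.
under eq_integral do rewrite uniform_onE.
rewrite ge0_integralZl_EFin//; last 2 first.
  by move=> t _; apply: sume_ge0 => i _; rewrite lee_fin.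
  exact: emeasurable_sum.
congr (_ * _)%E; rewrite ge0_integral_sum//; apply: eq_bigr => i _.
by rewrite -[X in h X]setIT -integral_indic.
Qed.

End integral_uniform_on.

End discrete_uniform.

(** * Complete mixability and mixtures *)

Lemma measurable_sum_tuple (R : realType) n :
  measurable_fun [set: n.-tuple R]
    (fun a : n.-tuple R => \sum_(i < n) tnth a i).
Proof. by apply: measurable_sum => i; exact: measurable_tnth. Qed.

Lemma ae_measure_eq (R : realType) d (T : measurableType d)
    (P : probability T R) (A B : set T) :
  measurable A -> measurable B -> {ae P, forall t, A t <-> B t} -> P A = P B.
Proof.
move=> mA mB AB; rewrite (measureDI P mA mB) (measureDI P mB mA) setIC.
have nAB : P.-negligible (A `\` B).
  by apply: negligibleS AB => t [At nBt] /= [AB _]; exact: nBt (AB At).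
have nBA : P.-negligible (B `\` A).
  by apply: negligibleS AB => t [Bt nAt] /= [_ BA]; exact: nAt (BA Bt).
by rewrite !(measure_negligible (measurableD _ _)).
Qed.

(** The vector [a] of atoms is chosen separately for each [t], so it need not be
    measurable.  Sorting makes it so: the event that the [k]-th smallest atom
    exceeds [x] is a condition on [dfun (G t) x] alone. *)
Lemma measurable_sorted_atoms (R : realType) n d (T : measurableType d)
    (mu : R) (G : T -> probability R R) :
  (forall t, discrete_uniform_with_mean n.+1 mu (G t)) ->
  (forall x, measurable_fun [set: T] (fun t => dfun (G t) x)) ->
  exists q : T -> n.+1.-tuple R,
    [/\ measurable_fun [set: T] q,
        forall t, \sum_(i < n.+1) tnth (q t) i = n.+1%:R * mu
      & forall t x, dfun (G t) x = uniform_on (q t) `]-oo, x]%classic].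
Proof.
move=> /choice[a aP] mG.
have rayE x : `]-oo, x]%classic = [set` (<= x)] :> set R.
  by apply/seteqP; split=> y /=; rewrite in_itv.
have dfunE t x : dfun (G t) x = uniform_on (a t) `]-oo, x]%classic.
  by rewrite /dfun (discrete_uniform_onE (aP t).1).
(* Entries are numbered from 0, hence the bound [k.+1]. *)
have lt_sortE t k x : (x < tnth (sort_tuple <=%R (a t)) k) =
    (dfun (G t) x < (k.+1%:R / n.+1%:R)%:E)%E.
  rewrite dfunE rayE uniform_on_count lte_fin ltr_pM2r ?invr_gt0// ltr_nat ltnS.
  by rewrite real_ltNge ?num_real// tnth_sort_tuple_le -leqNgt.
exists (fun t => sort_tuple <=%R (a t)); split=> [|t|t x].
- apply/measurable_fun_tnthP => k.
  apply: (measurability _ (RGenOInfty.measurableE R)) => _ [_ [x ->] <-].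
  rewrite setTI (_ : _ @^-1` _ =
      [set t | (dfun (G t) x < (k.+1%:R / n.+1%:R)%:E)%E]).
    by rewrite -[X in measurable X]setTI; exact: emeasurable_fun_infty_o.
  by apply/seteqP; split=> t /=; rewrite in_itv/= andbT lt_sortE.
- rewrite -(aP t).2 mulrC divfK// -(big_tuple _ _ _ xpredT id).
  rewrite -[RHS](big_tuple _ _ _ xpredT id).
  by apply: perm_big; exact/permPl/perm_sort.
- by rewrite dfunE uniform_on_sort.
Qed.

Lemma mixture_of_completely_mixable (R : realType) d (Omega : measurableType d)
    (P : probability Omega R) n (mu : R) (F : probability R R) :
  completely_mixable P n.+1 mu F ->
  exists (h : probability (n.+1.-tuple R) R)
      (Fa : n.+1.-tuple R -> probability R R),
    [/\ forall a, discrete_uniform_with_mean n.+1 mu (Fa a),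
        forall x, measurable_fun [set: n.+1.-tuple R] (fun a => dfun (Fa a) x)
      & forall x, dfun F x = (\int[h]_a dfun (Fa a) x)%E ].
Proof.
move=> [X [XF Xsum]].
pose Xt w := [tuple X i w | i < n.+1].
have mXt : measurable_fun [set: Omega] Xt.
  apply/measurable_fun_tnthP => i; rewrite (_ : _ \o _ = X i)//.
  by apply/funext => w; rewrite /= tnth_mktuple.
pose g (a : n.+1.-tuple R) : n.+1.-tuple R :=
  if \sum_(i < n.+1) tnth a i == n.+1%:R * mu then a else [tuple mu | i < n.+1].
have mg : measurable_fun [set: n.+1.-tuple R] g.
  apply: measurable_fun_ifT => //.
  by apply: measurable_fun_eqr => //; exact: measurable_sum_tuple.
exists (distribution P (mfun_Sub (mem_set mXt))), (fun a => uniform_on (g a)).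
split=> [a|x|x].
- exists (g a); split; first exact: discrete_uniform_on_uniform.
  rewrite /g; case: eqP => [->|_]; first by rewrite [_ * mu]mulrC mulfK.
  under eq_bigr do rewrite tnth_mktuple.
  by rewrite sumr_const card_ord -[mu *+ _]mulr_natr mulfK.
- exact: measurable_uniform_on.
- rewrite /dfun integral_uniform_on//.
  rewrite (eq_bigr (fun=> F `]-oo, x]%classic)) => [|i _].
    rewrite -[F _]fineK ?fin_num_measure// sumEFin sumr_const card_ord -EFinM.
    by rewrite -[fine _ *+ _]mulr_natl mulKf.
  rewrite -(XF i)//.
  pose ray : set R := `]-oo, x]%classic.
  apply: (@ae_measure_eq _ _ _ P [set w | ray (tnth (g (Xt w)) i)]
    (X i @^-1` ray)).
  + rewrite -[X in measurable X]setTI.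
    have mgX : measurable_fun [set: Omega] (g \o Xt) by exact: measurableT_comp.
    have /measurable_fun_tnthP/(_ i) mgXi := mgX.
    by apply: mgXi => //; exact: measurable_itv.
  + have mXi : measurable_fun [set: Omega] (X i) by [].
    rewrite -[X in measurable X]setTI; apply: mXi => //.
    exact: measurable_itv.
  + apply: filterS Xsum => w sw.
    have gX : g (Xt w) = Xt w.
      by rewrite /g; under eq_bigr do rewrite tnth_mktuple; rewrite sw eqxx.
    by rewrite /= gX tnth_mktuple.
Qed.

(** A random rotation of the sorted atoms makes all the entries have the same
    law, the average of the laws of the sorted atoms, without changing the
    sum. *)
Lemma completely_mixable_of_mixture (R : realType) d (Omega : measurableType d)
    (P : probability Omega R) n (mu : R) (F : probability R R)
    d' (T : measurableType d') (h : probability T R)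
    (G : T -> probability R R) :
  atomless P ->
  (forall t, discrete_uniform_with_mean n.+1 mu (G t)) ->
  (forall x, measurable_fun [set: T] (fun t => dfun (G t) x)) ->
  (forall x, dfun F x = (\int[h]_t dfun (G t) x)%E) ->
  completely_mixable P n.+1 mu F.
Proof.
move=> aP Gu mG FG; have [q [mq qsum qG]] := measurable_sorted_atoms Gu mG.
(* The addition of ['I_n.+1] is modulo [n.+1]. *)
pose rot (j : 'I_n.+1) t : n.+1.-tuple R :=
  [tuple tnth (q t) (i + j) | i < n.+1].
have mrot j : measurable_fun [set: T] (rot j).
  apply/measurable_fun_tnthP => i.
  rewrite (_ : _ \o _ = fun t => tnth (q t) (i + j)); last first.
    by apply/funext => t; rewrite /= tnth_mktuple.
  by have /measurable_fun_tnthP := mq; apply.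
pose Q : probability (n.+1.-tuple R) R :=
  average (fun j => distribution h (mfun_Sub (mem_set (mrot j)))).
have QE A : Q A = ((n.+1%:R)^-1%:E * \sum_(j < n.+1) h (rot j @^-1` A))%E.
  exact: averageE.
have [X [mX XQ]] := atomless_tuple Q aP.
have mXi i : measurable_fun [set: Omega] (fun w => tnth (X w) i).
  by have /measurable_fun_tnthP := mX; apply.
exists (fun i => mfun_Sub (mem_set (mXi i))); split=> [i|].
  apply: (dfun_unique (P := distribution P (mfun_Sub (mem_set (mXi i))))) => x.
  rewrite FG; under eq_integral do rewrite qG.
  rewrite integral_uniform_on//.
  rewrite /dfun /distribution /pushforward/=.
  transitivity (Q ((fun a => tnth a i) @^-1` `]-oo, x]%classic)).
    rewrite -XQ//; rewrite -[_ @^-1` _]setTI; exact: measurable_tnth.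
  rewrite QE; congr (_ * _)%E.
  rewrite [RHS](reindex_inj (addrI i))/=; apply: eq_bigr => j _.
  congr (h _).
  by apply/seteqP; split=> t /=; rewrite tnth_mktuple.
pose S : set (n.+1.-tuple R) :=
  [set a | (\sum_(i < n.+1) tnth a i == n.+1%:R * mu) = false].
have mS : measurable S.
  rewrite -[S]setTI.
  by apply: (measurable_fun_eqr (@measurable_sum_tuple R n.+1)
    (measurable_cst _) measurableT (Y := [set false])).
exists (X @^-1` S); split.
- by rewrite -[X in measurable X]setTI; exact: mX.
- rewrite XQ// QE big1 ?mule0// => j _.
  rewrite (_ : rot j @^-1` _ = set0) ?measure0//.
  apply/seteqP; split=> // t; rewrite /S/=.
  under eq_bigr do rewrite tnth_mktuple.
  have := qsum t; rewrite (reindex_inj (addIr j))/= => ->.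
  by rewrite eqxx.
- by move=> w /eqP/negbTE.
Qed.

Theorem theorem2 (R : realType) (d : measure_display)
    (Omega : measurableType d) (P : probability Omega R)
    (P_atomless : atomless P)
    (n : nat) (n_gt0 : (0 < n)%N) (mu : R) (F : probability R R) :
  completely_mixable P n mu F <->
  exists (h : probability (n.-tuple R) R) (Fa : n.-tuple R -> probability R R),
    [/\ forall a : n.-tuple R, discrete_uniform_with_mean n mu (Fa a),
        forall x : R,
          measurable_fun [set: n.-tuple R] (fun a : n.-tuple R => dfun (Fa a) x)
      & forall x : R, dfun F x = (\int[h]_a dfun (Fa a) x)%E ].
Proof.
case: n n_gt0 => // n _; split; first exact: mixture_of_completely_mixable.
by move=> [h [Fa [Fa_unif mFa FE]]]; exact: completely_mixable_of_mixture FE.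
Qed.
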